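(* Let $G$ be a finite simple undirected graph. The following are equivalent: (a) $G$ is a split graph; (b) $G$ is chordal and $\overline{G}$ is chordal; (c) $G$ has a vertex ordering $(v_1,\dots,v_n)$ that simultaneously satisfies: for all $i<j<k$, if $v_iv_j\in E(G)$ and $v_iv_k\in E(G)$ then $v_jv_k\in E(G)$; and for all $i<j<k$, if $v_iv_j\in E(G)$ then $v_jv_k\in E(G)$ or $v_iv_k\in E(G)$; (d) $G$ has a vertex ordering $(v_1,\dots,v_n)$ such that for all $i<j<k$, if $v_iv_j\in E(G)$ then $v_jv_k\in E(G)$.
   Context: A vertex ordering of $G$ is a total order $(v_1,\dots,v_n)$ of $V(G)$. The complement $\overline{G}$ has vertex set $V(G)$ and edge set $\{vw: v\ne w,\ vw\notin E(G)\}$. A graph is chordal if every induced cycle on at least four vertices has a chord (equivalently, has no induced cycle of length at least four). $G$ is a split graph if $V(G)=K\cup I$ where $K$ induces a complete subgraph and $I$ is an independent set. *)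

(* Defs.v *)
From mathcomp Require Import all_boot.
Set Implicit Arguments.
Unset Strict Implicit.
Unset Printing Implicit Defensive.

(* A finite simple graph is a finType of vertices with a symmetric and
   irreflexive adjacency relation. *)

Section Graphs.

Variable T : finType.
Implicit Types (e : rel T) (c : seq T) (K I : {set T}).

Definition compl_graph e : rel T := [rel x y | (x != y) && ~~ e x y].

Definition clique e K : Prop := {in K &, forall x y, x != y -> e x y}.

Definition independent e I : Prop := {in I &, forall x y, ~~ e x y}.

Definition split_graph e : Prop :=
  exists K I, [/\ K :|: I = setT, clique e K & independent e I].

Definition consecutive c : rel T :=
  [rel x y | (y == next c x) || (x == next c y)].

(* c lists, without repetition and in cyclic order, the vertices of a cycle. *)
Definition graph_cycle e c : Prop := 3 <= size c /\ ucycle e c.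

Definition induced_cycle e c : Prop :=
  graph_cycle e c /\ {in c &, forall x y, e x y = consecutive c x y}.

Definition chordal e : Prop :=
  ~ exists c, 4 <= size c /\ induced_cycle e c.

(* v enumerates the vertex set; indices start at 0. *)
Definition vertex_ordering (v : 'I_#|T| -> T) : Prop := bijective v.

End Graphs.

(* Main.v *)
Require Import Defs.
From mathcomp Require Import all_boot.

(** The implication from (b) to (a) is the only substantial one.  Chordality of
    [G] and of its complement excludes induced C4, C5 and 2K2.  Among the cliques
    of maximum size take [K] with the largest sum of degrees, and suppose [x y]
    is an edge outside [K].  Excluding C4 and 2K2 makes the sets of non-neighbours
    of [x] and [y] in [K] nested with at most one common element, so, say, [x]
    misses only [u] in [K], [y] misses [u], and by maximality of [#|K|] the
    vertex [y] misses a further [w] in [K].  Replacing [u] by [x] gives a clique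
    of the same size; since [y] is adjacent to [x] but not to [u], the choice of
    [K] yields a neighbour [z] of [u] not adjacent to [x].  Then [u, z, y, x, w]
    contains an induced 2K2, C4 or C5. *)

Set Implicit Arguments.
Unset Strict Implicit.
Unset Printing Implicit Defensive.

Section SplitGraphs.

Variable T : finType.
Implicit Types (e : rel T) (c : seq T) (K I : {set T}).

(** * Split graphs: stability under complement, and chordality *)

Lemma compl_graph_sym e : symmetric e -> symmetric (compl_graph e).
Proof. by move=> e_sym x y; rewrite /compl_graph /= eq_sym e_sym. Qed.

Lemma split_graph_compl e : split_graph e -> split_graph (compl_graph e).
Proof.
move=> [K [I [KI cK iI]]]; exists I, K; split; first by rewrite setUC.
  by move=> x y xI yI xy; rewrite /compl_graph /= xy iI.
move=> x y xK yK; rewrite /compl_graph /=; case: eqVneq => //= xy.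
by rewrite cK.
Qed.

Lemma split_edge e K I x y :
  K :|: I = setT -> independent e I -> e x y -> (x \in K) || (y \in K).
Proof.
move=> KI iI; apply: contraLR => /norP[xK yK].
have inI z : z \notin K -> z \in I.
  by move=> zK; have := in_setT z; rewrite -KI inE (negPf zK).
by apply: iI; apply: inI.
Qed.

(** Ensures that a vertex and its second successor on a long cycle are neither equal nor
    consecutive, so that an edge between them is a chord. *)
Lemma uniq_next4 c x : uniq c -> 4 <= size c -> x \in c ->
  uniq (traject (next c) x 4).
Proof.
move=> Uc sz /rot_to[i s Ec].
have c_rot : next c =1 next (x :: s) by move=> y; rewrite -Ec next_rot.
rewrite /= !c_rot.
have : uniq (x :: s) by rewrite -Ec rot_uniq.
have : 4 <= size (x :: s) by rewrite -Ec size_rot.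
case: s {Ec c_rot} => [|a [|b [|d s]]] //= _.
rewrite !inE !negb_or -!andbA eqxx.
move=> /and5P[xa xb xd _ /and5P[ab ad _ bd _]].
rewrite (eq_sym a x) (negPf xa) !eqxx.
rewrite (eq_sym b x) (negPf xb) (eq_sym b a) (negPf ab).
by rewrite xd ad bd.
Qed.

(** Every edge of the cycle meets [K], but two vertices that are two steps apart on it cannot both
    lie in [K], as they would span a chord. *)
Lemma split_graph_chordal e : split_graph e -> chordal e.
Proof.
move=> [K [I [KI cK iI]]] [c [sz [[_ /andP[cyc Uc]] ind]]].
pose f := next c.
have fc x : x \in c -> f x \in c by rewrite mem_next.
have edge x : x \in c -> x \notin K -> f x \in K.
  move=> xc /negPf xK; have := split_edge KI iI (next_cycle cyc xc).
  by rewrite xK.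
have chord x : x \in c -> x \in K -> f (f x) \notin K.
  move=> xc xK; apply/negP=> ffxK.
  have := uniq_next4 Uc sz xc; rewrite /= !inE !negb_or -!andbA -/f.
  move=> /and5P[_ xf2 xf3 f12 _].
  have := cK _ _ xK ffxK xf2; rewrite ind ?fc // /consecutive /= -/f.
  by rewrite eq_sym (negPf f12) (negPf xf3).
(* If [x] is in [K], then [f (f x)] is not, which forces both [f x] and [f (f (f x))] into [K],
   although these are two steps apart. *)
have cNK x : x \in c -> x \notin K.
  move=> xc; apply/negP=> xK.
  have ffxK := chord _ xc xK.
  have fxK : f x \in K.
    apply: contraT => fxK.
    by rewrite (edge _ (fc _ xc) fxK) in ffxK.
  have := chord _ (fc _ xc) fxK.
  by rewrite (edge _ (fc _ (fc _ xc)) ffxK).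
case: c sz {cyc Uc ind} @f fc edge chord cNK => // x c _ f fc edge _ cNK.
have xc : x \in x :: c by rewrite mem_head.
by have := cNK _ (fc _ xc); rewrite edge // cNK.
Qed.

(** * Excluded induced subgraphs: C4, C5 and 2K2 *)

Lemma chordal_noC4 e (a b c d : T) : symmetric e -> irreflexive e -> chordal e ->
  a != c -> b != d -> e a b -> e b c -> e c d -> e d a ->
  ~~ e a c -> e b d.
Proof.
move=> e_sym e_irr che nac nbd eab ebc ecd eda nEac.
apply: contraT => nEbd; case: che.
have neq x y : e x y -> (x == y) = false.
  by apply: contraTF => /eqP->; rewrite e_irr.
have sym x y : e x y -> e y x by rewrite e_sym.
have adj x y : e x y -> (e x y = true) * (e y x = true).
  by rewrite [e y x]e_sym.
have nadj x y : ~~ e x y -> (e x y = false) * (e y x = false).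
  by rewrite [e y x]e_sym => /negPf.
have Dac := negPf nac; have Dbd := negPf nbd.
have Dca : (c == a) = false by rewrite eq_sym.
have Ddb : (d == b) = false by rewrite eq_sym.
have D1 := neq _ _ eab; have D2 := neq _ _ ebc.
have D3 := neq _ _ ecd; have D4 := neq _ _ eda.
have D5 := neq _ _ (sym _ _ eab); have D6 := neq _ _ (sym _ _ ebc).
have D7 := neq _ _ (sym _ _ ecd); have D8 := neq _ _ (sym _ _ eda).
exists [:: a; b; c; d]; split=> //; split; first split=> //.
  apply/andP; split; first by rewrite /= eab ebc ecd eda.
  by rewrite /= !inE !negb_or D1 nac D2 nbd D8 D3.
move=> x y; rewrite !inE => /or4P[]/eqP-> /or4P[]/eqP->;
  rewrite /consecutive /=;
  rewrite ?(Dac, Dbd, Dca, Ddb, D1, D2, D3, D4, D5, D6, D7, D8, eqxx) /=;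
  by rewrite ?(e_irr, adj _ _ eab, adj _ _ ebc, adj _ _ ecd, adj _ _ eda,
               nadj _ _ nEac, nadj _ _ nEbd).
Qed.

(** Two nonadjacent vertices of the 5-cycle are told apart by a third one adjacent to exactly one of
    them, so distinctness follows from the adjacencies. *)
Lemma chordal_noC5 e (a b c d f : T) : symmetric e -> irreflexive e -> chordal e ->
  e a b -> e b c -> e c d -> e d f -> e f a ->
  ~~ e a c -> ~~ e b d -> ~~ e c f -> ~~ e d a -> e f b.
Proof.
move=> e_sym e_irr che eab ebc ecd edf efa nac nbd ncf nda.
apply: contraT => nfb; case: che.
have sym x y : e x y -> e y x by rewrite e_sym.
have neq x y z : e x z -> ~~ e y z -> ((x == y) = false) * ((y == x) = false).
  by move=> exz nyz; split; apply: contraNF nyz => /eqP; [move<- | move->].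
have adj x y : e x y -> (e x y = true) * (e y x = true).
  by rewrite [e y x]e_sym.
have nadj x y : ~~ e x y -> (e x y = false) * (e y x = false).
  by rewrite [e y x]e_sym => /negPf.
have neq' x y : e x y -> ((x == y) = false) * ((y == x) = false).
  by move=> exy; apply: neq exy _; rewrite e_irr.
have Dac := neq _ _ _ (sym _ _ efa) ncf.
have Dbd := neq _ _ _ (sym _ _ eab) nda.
have Dcf := neq _ _ _ (sym _ _ ebc) nfb.
have Dda := neq _ _ _ (sym _ _ ecd) nac.
have Dfb := neq _ _ _ (sym _ _ edf) nbd.
have D1 := neq' _ _ eab; have D2 := neq' _ _ ebc; have D3 := neq' _ _ ecd.
have D4 := neq' _ _ edf; have D5 := neq' _ _ efa.
exists [:: a; b; c; d; f]; split=> //; split; first split=> //.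
  apply/andP; split; first by rewrite /= eab ebc ecd edf efa.
  by rewrite /= !inE !negb_or Dac Dbd Dcf Dda Dfb D1 D2 D3 D4 D5.
have inE5 x : x \in [:: a; b; c; d; f] ->
    [\/ x = a, x = b, x = c | x = d \/ x = f].
  rewrite !inE => /or4P[/eqP|/eqP|/eqP|/orP[]/eqP] ->;
    by [apply: Or41|apply: Or42|apply: Or43|apply: Or44; left|apply: Or44; right].
move=> x y /inE5[->|->|->|[]->] /inE5[->|->|->|[]->];
  rewrite /consecutive /=;
  rewrite ?(Dac, Dbd, Dcf, Dda, Dfb, D1, D2, D3, D4, D5, eqxx) /=;
  by rewrite ?(e_irr, adj _ _ eab, adj _ _ ebc, adj _ _ ecd, adj _ _ edf,
               adj _ _ efa, nadj _ _ nac, nadj _ _ nbd, nadj _ _ ncf,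
               nadj _ _ nda, nadj _ _ nfb).
Qed.

(** The complement of 2K2 is the 4-cycle [a], [c], [b], [d], whose diagonals are the two given
    edges. *)
Lemma cochordal_no2K2 e (a b c d : T) : symmetric e -> irreflexive e ->
  chordal (compl_graph e) ->
  a != c -> a != d -> b != c -> b != d ->
  e a b -> e c d -> ~~ e a c -> ~~ e a d -> ~~ e b c -> e b d.
Proof.
move=> e_sym e_irr che nac nad nbc nbd eab ecd nEac nEad nEbc.
apply: contraT => nEbd.
have neq x y : e x y -> x != y.
  by apply: contraTneq => ->; rewrite e_irr.
have := @chordal_noC4 (compl_graph e) a c b d (compl_graph_sym e_sym) _ che.
rewrite /compl_graph /= !(neq _ _ eab) !(neq _ _ ecd) nac nEac.
rewrite (eq_sym c b) nbc (e_sym c b) nEbc nbd nEbd (eq_sym d) nad (e_sym d) nEad.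
rewrite eab ecd /= => H; apply: H => //.
by move=> x /=; rewrite eqxx.
Qed.

(** * From chordality of the graph and its complement to a split partition *)

(** Otherwise the neighbours of [u] would form a subset of those of [x], proper because of [y], and
    [u] would have smaller degree. *)
Lemma degree_exchange e x y u : e x y -> ~~ e u y ->
  #|[set z | e x z]| <= #|[set z | e u z]| ->
  exists2 z, e u z & ~~ e x z.
Proof.
move=> exy nuy le; apply/exists_inP; apply: contraLR le.
rewrite negb_exists_in -ltnNge => /forall_inP sub.
apply/proper_card/properP; split.
  by apply/subsetP=> z; rewrite !inE => /sub; rewrite negbK.
by exists y; rewrite inE.
Qed.

Lemma chordal_cochordal_split e : symmetric e -> irreflexive e ->
  chordal e -> chordal (compl_graph e) -> split_graph e.
Proof.
move=> e_sym e_irr che chce.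
pose cliqueb K := [forall x in K, forall y in K, (x != y) ==> e x y].
have cliqueP K : reflect (clique e K) (cliqueb K).
  apply: (iffP forall_inP) => [H x y xK yK xy | H x xK].
    by have /forall_inP/(_ _ yK)/implyP-> := H _ xK.
  by apply/forall_inP=> y yK; apply/implyP; apply: H.
pose weight K := \sum_(x in K) #|[set z | e x z]|.
have [K [cK maxK maxW]] : exists K, [/\ clique e K,
    forall K', clique e K' -> #|K'| <= #|K| &
    forall K', clique e K' -> #|K'| = #|K| -> weight K' <= weight K].
  (* Two successive maximizations: of the size over all cliques, then of [weight] over the cliques
     of the size found. *)
  have c0 : cliqueb set0 by apply/forall_inP=> x; rewrite inE.
  case: (arg_maxnP (fun K => #|K|) c0) => K0 cK0 max0.
  have c1 : cliqueb K0 && (#|K0| == #|K0|) by rewrite cK0 eqxx.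
  case: (@arg_maxnP _ K0 (fun K => cliqueb K && (#|K| == #|K0|)) weight c1).
  move=> K /andP[/cliqueP cK /eqP szK] maxK; exists K; split=> //.
    by move=> K' /cliqueP cK'; rewrite szK; apply: max0.
  move=> K' /cliqueP cK' szK'; apply: maxK.
  by rewrite cK' szK' szK eqxx.
have neqK x u : x \notin K -> u \in K -> x != u.
  by move=> xK; apply: contraTneq => <-.
have cliqueU x K' : clique e K' -> {in K', forall u, e x u} -> clique e (x |: K').
  move=> cK' xK' p q; rewrite !inE => /orP[/eqP->|pK] /orP[/eqP->|qK] pq.
  - by rewrite eqxx in pq.
  - exact: xK'.
  - by rewrite e_sym xK'.
  - exact: cK'.
have cliqueD u : clique e (K :\ u).
  by move=> p q; rewrite !inE => /andP[_ pK] /andP[_ qK]; apply: cK.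
have miss x : x \notin K -> exists2 u, u \in K & ~~ e x u.
  move=> xK; apply/exists_inP; apply: contraT.
  rewrite negb_exists_in => /forall_inP adj.
  have : clique e (x |: K) by apply: cliqueU => // u /adj; rewrite negbK.
  by move/maxK; rewrite cardsU1 xK ltnn.
exists K, (~: K); split=> //; first exact: setUCr.
move=> x0 y0; rewrite !inE => x0K y0K; apply/negP=> exy0.
(* Distinct [u] and [v] would make [x y] and [u v] an induced 2K2. *)
have no_common x y u v : x \notin K -> y \notin K -> e x y ->
    u \in K -> v \in K -> ~~ e x u -> ~~ e y u -> ~~ e x v -> ~~ e y v -> u = v.
  move=> xK yK exy uK vK xu yu xv; apply: contraNeq => uv.
  by apply: (@cochordal_no2K2 e x y u v) => //; do ?exact: neqK; exact: cK.
(* A vertex [u] of [K] adjacent to [y] but not to [x] would close the induced 4-cycle [x], [w], [u],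
   [y]. *)
have nested x y : x \notin K -> y \notin K -> e x y ->
    (exists2 w, w \in K & e x w && ~~ e y w) ->
    {in K, forall u, ~~ e x u -> ~~ e y u}.
  move=> xK yK exy [w wK /andP[xw yw]] u uK xu; apply/negP=> yu.
  have wu : w != u by apply: contraTneq xw => ->.
  have := @chordal_noC4 e x w u y e_sym e_irr che.
  rewrite (neqK x u) // eq_sym neqK // xw cK // e_sym yu e_sym exy xu e_sym.
  by rewrite (negPf yw) => /(_ isT isT isT isT isT isT isT).
have key x y w : x \notin K -> y \notin K -> e x y ->
    w \in K -> e x w -> ~~ e y w -> False.
  move=> xK yK exy wK xw yw.
  have sub := nested _ _ xK yK exy (ex_intro2 _ _ w wK (introT andP (conj xw yw))).
  have [u uK xu] := miss _ xK; have yu := sub _ uK xu.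
  have x_only v : v \in K -> v != u -> e x v.
    move=> vK; apply: contraNT => xv.
    by apply/eqP/(no_common x y) => //; apply: sub.
  have xDu : x \notin K :\ u by rewrite !inE (negPf xK) andbF.
  have cK' : clique e (x |: K :\ u).
    by apply: cliqueU => // v; rewrite !inE => /andP[vu vK]; apply: x_only.
  have szK' : #|x |: K :\ u| = #|K| by rewrite cardsU1 xDu (cardsD1 u K) uK.
  (* Cancelling the common part [K :\ u] of the two weights bounds the degree of [x] by that of
     [u]. *)
  have := maxW _ cK' szK'; rewrite /weight big_setU1 //= (big_setD1 u uK) leq_add2r.
  move=> /(degree_exchange exy); rewrite e_sym => /(_ yu)[z uz xz].
  have wu : w != u by apply: contraTneq xw => ->.
  have zx : z != x by apply: contraTneq uz => ->; rewrite e_sym.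
  have zy : z != y by apply: contraTneq uz => ->; rewrite e_sym.
  (* Otherwise [x y] and [u z] form an induced 2K2. *)
  have yz : e y z.
    apply: (@cochordal_no2K2 e x y u z) => //; rewrite ?(neqK _ u) //.
      by rewrite eq_sym.
    by rewrite eq_sym.
  (* The pair [z w] decides between an induced 4-cycle [z], [y], [x], [w] and an induced 5-cycle
     [u], [z], [y], [x], [w]. *)
  have [zw | zw] := boolP (e z w).
    have := @chordal_noC4 e z y x w e_sym e_irr che zx (neqK _ _ yK wK).
    rewrite e_sym yz e_sym exy xw e_sym zw e_sym xz (negPf yw).
    by move=> /(_ isT isT isT isT isT).
  have := @chordal_noC5 e u z y x w e_sym e_irr che uz.
  rewrite e_sym yz e_sym exy xw cK // e_sym yu e_sym xz yw xu e_sym (negPf zw).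
  by move=> /(_ isT isT isT isT isT isT isT isT).
have [u uK xu] := miss _ x0K.
have [yu | yu] := boolP (e y0 u).
  by apply: (key y0 x0 u) => //; rewrite e_sym.
(* By [key] in both directions [x0] and [y0] miss the same vertices of [K], hence only [u];
   replacing [u] by both of them then gives a clique larger than [K]. *)
have both v : v \in K -> v != u -> e x0 v && e y0 v.
  move=> vK vu; have [xv | xv] := boolP (e x0 v).
    by apply: contraT => yv; case: (key x0 y0 v).
  have [yv | yv] := boolP (e y0 v).
    by case: (key y0 x0 v); rewrite // e_sym.
  by rewrite (no_common x0 y0 u v) ?eqxx in vu.
have : clique e (x0 |: (y0 |: K :\ u)).
  apply: (cliqueU) => [|v]; first apply: (cliqueU) => // v.
    by rewrite !inE => /andP[vu vK]; case/andP: (both _ vK vu).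
  rewrite !inE => /orP[/eqP->//|/andP[vu vK]].
  by case/andP: (both _ vK vu).
move/maxK; rewrite !cardsU1 !inE (negPf x0K) (negPf y0K) !andbF orbF.
have -> : x0 != y0 by apply: contraTneq exy0 => ->; rewrite e_irr.
by rewrite (cardsD1 u K) uK ltnn.
Qed.

(** * Vertex orderings and the equivalence *)

(** Listing the complement of [K] first turns membership in [K] into a lower bound on the index. *)
Lemma ordering_last K : exists2 v : 'I_#|T| -> T, vertex_ordering v &
  forall i j : 'I_#|T|, i < j -> v i \in K -> v j \in K.
Proof.
pose s := enum (~: K) ++ enum K.
have sz : size s == #|T| by rewrite size_cat -!cardE addnC cardsC.
have Us : uniq s.
  rewrite cat_uniq !enum_uniq andbT; apply/hasPn=> x /=.
  by rewrite !mem_enum !inE negbK.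
pose v := tnth (Tuple sz).
have vK i : (v i \in K) = (#|~: K| <= i).
  (* [T] may be empty, so the default value for [nth] is taken from the index [i] at hand. *)
  have x0 := v i; rewrite /v (tnth_nth x0) /= nth_cat -cardE.
  case: ltnP => lt_i.
    have: nth x0 (enum (~: K)) i \in ~: K.
      by rewrite -mem_enum mem_nth // -cardE.
    by rewrite inE => /negPf.
  rewrite -mem_enum mem_nth // -cardE ltn_subLR //.
  by rewrite addnC cardsC ltn_ord.
exists v; last by move=> i j ij; rewrite !vK => /leq_trans-> //; apply: ltnW.
apply: inj_card_bij; last by rewrite card_ord.
exact/tuple_uniqP.
Qed.

End SplitGraphs.

Theorem theorem10 (T : finType) (e : rel T)
    (e_sym : symmetric e) (e_irr : irreflexive e) :
  [<-> split_graph e;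
       chordal e /\ chordal (compl_graph e);
       exists v : 'I_#|T| -> T,
         [/\ vertex_ordering v,
             forall i j k : 'I_#|T|, i < j -> j < k ->
               e (v i) (v j) -> e (v i) (v k) -> e (v j) (v k)
           & forall i j k : 'I_#|T|, i < j -> j < k ->
               e (v i) (v j) -> e (v j) (v k) \/ e (v i) (v k)];
       exists v : 'I_#|T| -> T,
         vertex_ordering v /\
         forall i j k : 'I_#|T|, i < j -> j < k ->
           e (v i) (v j) -> e (v j) (v k)].
Proof.
tfae.
- by move=> sG; split; apply: split_graph_chordal => //; apply: split_graph_compl.
- move=> [che chce].
  have [K [I [KI cK iI]]] := chordal_cochordal_split e_sym e_irr che chce.
  have [v v_bij vK] := ordering_last K.
  (* With the clique [K] placed last, the later end of any edge lies in [K], and so does everything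
     after it. *)
  have edge (i j k : 'I_#|T|) : i < j -> j < k -> e (v i) (v j) -> e (v j) (v k).
    move=> ij jk eij.
    have jK : v j \in K.
      by case/orP: (split_edge KI iI eij) => // /(vK _ _ ij).
    apply: cK => //; first exact: vK jK.
    by rewrite (inj_eq (bij_inj v_bij)) neq_ltn jk.
  exists v; split=> // i j k ij jk eij; first by move=> _; apply: edge eij.
  by left; apply: edge eij.
- move=> [v [v_bij fwd alt]]; exists v; split=> // i j k ij jk eij.
  by case: (alt i j k ij jk eij) => // eik; apply: fwd eik.
- move=> [v [[w vK wK] fwd]].
  (* The clique side consists of the vertices with an earlier neighbour: by [fwd] each is adjacent
     to everything after it. An edge outside [K] is impossible, since its later end has an earlier
     neighbour. *)
  pose K := [set x | [exists i : 'I_#|T|, (i < w x) && e (v i) x]].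
  have later x y : x \in K -> w x < w y -> e x y.
    rewrite inE => /existsP[i /andP[ix eix]] xy.
    by rewrite -(wK x) -(wK y); apply: (fwd i) => //; rewrite wK.
  have early x y : y \notin K -> w x < w y -> ~~ e x y.
    rewrite inE negb_exists => /forallP/(_ (w x)) + xy.
    by rewrite xy wK.
  exists K, (~: K); split; first exact: setUCr.
    move=> x y xK yK xy.
    have : w x != w y by apply: contraNneq xy => /(can_inj wK)->.
    by rewrite neq_ltn => /orP[] lt; [|rewrite e_sym]; apply: later.
  move=> x y; rewrite !inE => xK yK.
  case: (ltngtP (w x) (w y)) => [lt|lt|/val_inj/(can_inj wK)->].
  + by apply: early; rewrite ?inE.
  + by rewrite e_sym; apply: early; rewrite ?inE.
  + by rewrite e_irr.
Qed.
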